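(* Let $G$ be a Tarski monster group. Then the $G$-action on the Furstenberg boundary $\partial_F G$ is topologically free.
   Context: For a prime $p$, a Tarski monster group of order $p$ is a finitely generated non-amenable infinite group in which every nontrivial proper subgroup is cyclic of order $p$. The Furstenberg boundary $\partial_F G$ is the universal $G$-boundary: a compact $G$-space that is minimal (all orbits dense) and strongly proximal (for every probability measure $\nu$ the weak* closure of $G\nu$ contains a point mass), of which every such $G$-space is a continuous $G$-equivariant image. An action of $G$ on a compact space $X$ is topologically free if for every $s\in G\setminus\{e\}$ the set $\{x\in X: sx\neq x\}$ is dense in $X$. *)

(* Defs.v *)
From HB Require Import structures.
From mathcomp Require Import all_boot all_order all_algebra.
From mathcomp Require Import all_classical all_reals topology Rstruct Rstruct_topology.
Set Implicit Arguments. Unset Strict Implicit. Unset Printing Implicit Defensive.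
Import Order.TTheory GRing.Theory Num.Theory.
Local Open Scope classical_set_scope.
Local Open Scope card_scope.
Local Open Scope ring_scope.

Notation RR := Rdefinitions.R.

Section GroupDefs.
Variable G : groupType.

Definition is_subgroup (H : set G) : Prop :=
  [/\ H 1%g, (forall x y, H x -> H y -> H (x * y)%g) & (forall x, H x -> H (x^-1)%g)].

Definition gen_subgroup (S : set G) : set G :=
  [set x | forall H, is_subgroup H -> S `<=` H -> H x].

Definition finitely_generated : Prop :=
  exists s : seq G, gen_subgroup [set x | x \in s] = setT.

Definition cyclic_of_order (H : set G) (p : nat) : Prop :=
  exists g : G, H = [set (g ^+ n)%g | n in [set: nat]] /\ H #= `I_p.

Definition amenable : Prop :=
  exists m : set G -> RR,
    [/\ forall A, 0 <= m A,
        m setT = 1,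
        (forall A B, A `&` B = set0 -> m (A `|` B) = m A + m B) &
        (forall g A, m [set (g * x)%g | x in A] = m A)].

Definition tarski_monster (p : nat) : Prop :=
  [/\ prime p, finitely_generated, ~ finite_set [set: G], ~ amenable &
      forall H : set G, is_subgroup H -> H <> [set 1%g] -> H <> setT ->
        cyclic_of_order H p].

Definition is_tarski_monster : Prop := exists p, tarski_monster p.

Section Actions.
Variable X : topologicalType.
Variable act : G -> X -> X.

Definition is_continuous_action : Prop :=
  [/\ forall g, continuous (act g),
      forall x, act 1%g x = x &
      forall g h x, act (g * h)%g x = act g (act h x)].

Definition compact_hausdorff_nonempty : Prop :=
  [/\ compact [set: X], hausdorff_space X & [set: X] !=set0].

Definition orbit (x : X) : set X := [set act g x | g in [set: G]].

Definition minimal_action : Prop := forall x, closure (orbit x) = setT.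

(** probability measures on X, viewed (Riesz) as states on C(X):
    positive normalised linear functionals on continuous real functions *)
Definition state (nu : (X -> RR) -> RR) : Prop :=
  [/\ forall f h : X -> RR, continuous f -> continuous h ->
        nu (fun x => f x + h x) = nu f + nu h,
      forall (c : RR) (f : X -> RR), continuous f -> nu (fun x => c * f x) = c * nu f,
      forall f : X -> RR, continuous f -> (forall x, 0 <= f x) -> 0 <= nu f &
      nu (fun _ => 1 : RR) = 1].

Definition translate_state (g : G) (nu : (X -> RR) -> RR) : (X -> RR) -> RR :=
  fun f => nu (fun y => f (act g y)).

(** the point mass delta_x lies in the weak* closure of {g.nu | g in G}
    (written with the basic weak* neighbourhoods of delta_x) *)
Definition in_weakstar_closure_orbit (nu : (X -> RR) -> RR) (x : X) : Prop :=
  forall (n : nat) (fs : 'I_n -> (X -> RR)) (eps : RR), 0 < eps ->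
    (forall i, continuous (fs i)) ->
    exists g : G, forall i, `| translate_state g nu (fs i) - fs i x | < eps.

Definition strongly_proximal : Prop :=
  forall nu, state nu -> exists x : X, in_weakstar_closure_orbit nu x.

Definition G_boundary : Prop :=
  [/\ is_continuous_action, compact_hausdorff_nonempty,
      minimal_action & strongly_proximal].

Definition topologically_free : Prop :=
  forall s : G, s <> 1%g -> dense [set x | act s x <> x].

End Actions.

Definition furstenberg_boundary (X : topologicalType) (act : G -> X -> X) : Prop :=
  G_boundary act /\
  forall (Y : topologicalType) (actY : G -> Y -> Y), G_boundary actY ->
    exists f : X -> Y, [/\ continuous f,
      (forall g x, f (act g x) = actY g (f x)) & f @` setT = setT].

End GroupDefs.

(* Main.v *)
From HB Require Import structures.
Require Import Defs.
From mathcomp Require Import all_boot all_order all_algebra.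
From mathcomp Require Import all_classical all_reals topology Rstruct Rstruct_topology.
From mathcomp Require Import normedtype derive zify finmap lra.

(** If no boundary distinguished two points, [G] would be amenable: let [p] be a
    minimal [G]-invariant sublinear functional on the bounded functions on [G]
    below the supremum, and let [X] be the least weak* closed set of linear
    forms dominated by [p] on which every [f] attains the value [p f].  For a
    state [nu] on [C(X)], the functional [f |-> sup_g nu (g f)] is invariant and
    below [p], so it is [p]; since every neighbourhood of a point of [X]
    contains the peak of some [f], translates of [nu] concentrate at every point
    of [X].  Thus [X] is a boundary, and if it is a point then [p] is an
    invariant mean.

    Hence no point of the Furstenberg boundary of a Tarski monster is fixed by
    the whole group.  If [s <> 1] fixed an open set pointwise, minimality and
    compactness would give finitely many conjugates of [s] such that every point
    is fixed by one of them.  The stabilizers, having prime order, would be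
    finitely many; each would be normalized by an infinite subgroup, hence be
    normal in [G], and a Tarski monster has no proper nontrivial normal
    subgroup. *)

Set Implicit Arguments. Unset Strict Implicit. Unset Printing Implicit Defensive.
Import Order.TTheory GRing.Theory Num.Theory.
Import numFieldNormedType.Exports.
Local Open Scope classical_set_scope.
Local Open Scope ring_scope.

(** * Sublinear functionals, minimality and dominated linear forms *)

Section SublinearFunctionals.
Variable V : lmodType RR.
Implicit Types (p q : V -> RR) (u v w : V).

(** Homogeneity is asked only as an inequality, which passes to infima; applied to [c^-1] it yields
    the equality. *)
Definition sublinear p :=
  (forall u v, p (u + v) <= p u + p v) /\
  (forall (c : RR) u, 0 < c -> p (c *: u) <= c * p u).

Definition linear_form p :=
  (forall u v, p (u + v) = p u + p v) /\ (forall (c : RR) u, p (c *: u) = c * p u).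

Lemma sublinear0 p : sublinear p -> p 0 = 0.
Proof.
move=> [pD pZ]; have := pD 0 0; rewrite addr0 => p00.
have := pZ (2^-1) 0; rewrite scaler0 => /(_ ltac:(lra)); lra.
Qed.

Lemma sublinearZ p (c : RR) u : sublinear p -> 0 <= c -> p (c *: u) = c * p u.
Proof.
move=> sp; rewrite le_eqVlt => /predU1P[<-|c0].
  by rewrite scale0r mul0r sublinear0.
apply/eqP; rewrite eq_le sp.2 //=.
have := sp.2 c^-1 (c *: u); rewrite invr_gt0 scalerA mulVf ?gt_eqF // scale1r.
by move=> /(_ c0); rewrite mulrC ler_pdivlMr // mulrC.
Qed.

Lemma sublinearN p u : sublinear p -> - p (- u) <= p u.
Proof.
move=> sp; have := sp.1 u (- u); rewrite subrr sublinear0 // => ?; lra.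
Qed.

Lemma linear_formN p u : linear_form p -> p (- u) = - p u.
Proof. by move=> [_ pZ]; rewrite -scaleN1r pZ mulN1r. Qed.

Definition invariant_under (T : set (V -> V)) p :=
  forall t, T t -> forall v, p (t v) = p v.

(** Zorn's lemma for the reversed pointwise order. A nonempty chain is bounded by its pointwise
    infimum, finite because [q v >= - q (- v) >= - p0 (- v)] for each member [q]. *)
Lemma exists_minimal_sublinear (T : set (V -> V)) p0 :
  sublinear p0 -> invariant_under T p0 ->
  exists p, [/\ sublinear p, invariant_under T p, forall v, p v <= p0 v &
    forall q, sublinear q -> invariant_under T q ->
      (forall v, q v <= p v) -> q = p].
Proof.
move=> s0 i0.
pose D := {p | [/\ sublinear p, invariant_under T p & forall v, p v <= p0 v]}.
pose R (p q : D) := `[< forall v, sval q v <= sval p v >].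
have [||||[p Pp] pmin] := @Zorn D R.
- by move=> p; apply/asboolP => v.
- move=> p q r /asboolP pq /asboolP qr; apply/asboolP => v.
  exact: le_trans (qr v) (pq v).
- move=> [p Pp] [q Pq] /asboolP pq /asboolP qp; apply: eq_exist; apply/funext => v.
  by apply/eqP; rewrite eq_le [_ <= _]qp [_ <= _]pq.
- move=> A totA; have [[q0 Aq0]|A0] := pselect (exists q : D, A q); last first.
    have P0 : [/\ sublinear p0, invariant_under T p0 & forall v, p0 v <= p0 v] by [].
    by exists (exist _ p0 P0) => s As; case: A0; exists s.
  pose S v := [set sval (q : D) v | q in A].
  have S0 v : S v !=set0 by exists (sval q0 v), q0.
  have lbS v : lbound (S v) (- p0 (- v)).
    move=> _ [[q [sq iq lq]] _ <-] /=.
    by apply: le_trans (sublinearN _ sq); rewrite lerN2.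
  have infle v (q : D) : A q -> inf (S v) <= sval q v.
    by move=> Aq; apply: ge_inf; [exists (- p0 (- v))|exists q].
  have leinf v c : (forall q : D, A q -> c <= sval q v) -> c <= inf (S v).
    by move=> h; apply: lb_le_inf => // _ [q Aq <-]; exact: h.
  have Pinf : [/\ sublinear (fun v => inf (S v)),
      invariant_under T (fun v => inf (S v)) & forall v, inf (S v) <= p0 v].
    split; first split.
    + move=> u v; rewrite -lerBlDr; apply: (leinf _) => q1 Aq1.
      rewrite lerBlDr -lerBlDl; apply: (leinf _) => q2 Aq2; rewrite lerBlDl.
      (* The smaller of [q1] and [q2] serves for both arguments, so subadditivity survives the
         infimum. *)
      have [/asboolP h|/asboolP h] := totA _ _ Aq1 Aq2.
        apply: le_trans (infle _ _ Aq2) _; case: (q2) h => q [sq _ _] /= h.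
        by apply: le_trans (sq.1 _ _) _; rewrite lerD2r h.
      apply: le_trans (infle _ _ Aq1) _; case: (q1) h => q [sq _ _] /= h.
      by apply: le_trans (sq.1 _ _) _; rewrite lerD2l h.
    + move=> c u c0; rewrite mulrC -ler_pdivrMr //; apply: (leinf _) => q Aq.
      rewrite ler_pdivrMr //; apply: le_trans (infle _ _ Aq) _.
      by rewrite mulrC; case: (q) => r [sr _ _] /=; exact: sr.2.
    + move=> t Tt v; congr inf; apply/seteqP; split => _ [q Aq <-]; exists q => //;
        by case: (q) => r [_ ir _] /=; rewrite ir.
    + by move=> v; apply: le_trans (infle _ _ Aq0) _; case: (q0) => r [].
  exists (exist _ (fun v => inf (S v)) Pinf : D) => q Aq.
  by apply/asboolP => v; exact: infle.
exists p; case: (Pp) => sp ip lp; split => // q sq iq qp.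
have Pq : [/\ sublinear q, invariant_under T q & forall v, q v <= p0 v].
  by split => // v; exact: le_trans (qp v) (lp v).
by have := pmin (exist _ q Pq); move=> /(_ (asboolT qp)) [].
Qed.

(* Minimality of [p] forces [tilt p f = p], which makes [p] odd at [f]; minimal
   elements below [tilt p f] are linear forms attaining [p] at [f]. *)
Definition tilt p (f v : V) : RR :=
  inf [set p (v + t *: f) - t * p f | t in [set t : RR | 0 <= t]].

Section Tilt.
Variables (p : V -> RR) (f : V).
Hypothesis sp : sublinear p.

Lemma tilt_ge (c : RR) v :
  (forall t : RR, 0 <= t -> c <= p (v + t *: f) - t * p f) -> c <= tilt p f v.
Proof.
move=> h; apply: lb_le_inf; first by exists (p (v + 0 *: f) - 0 * p f), 0 => /=.
by move=> _ [t /= t0 <-]; exact: h.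
Qed.

Lemma tilt_le (t : RR) v : 0 <= t -> tilt p f v <= p (v + t *: f) - t * p f.
Proof.
move=> t0; apply: ge_inf; last by exists t.
(* The infimum is finite: subadditivity gives [p (s *: f) <= p (v + s *: f) + p (- v)]. *)
exists (- p (- v)) => _ [s /= s0 <-]; rewrite -sublinearZ //.
by have := sp.1 (v + s *: f) (- v); rewrite addrAC subrr add0r; lra.
Qed.

Lemma tilt_sublinear : sublinear (tilt p f).
Proof.
split=> [u v|c u c0].
  rewrite -lerBlDr; apply: tilt_ge => s s0; rewrite lerBlDr -lerBlDl.
  apply: tilt_ge => t t0; rewrite lerBlDl.
  apply: le_trans (tilt_le _ (addr_ge0 s0 t0)) _.
  have := sp.1 (u + s *: f) (v + t *: f).
  by rewrite addrACA -scalerDl mulrDl; lra.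
rewrite mulrC -ler_pdivrMr //; apply: tilt_ge => t t0; rewrite ler_pdivrMr //.
apply: le_trans (tilt_le _ (mulr_ge0 (ltW c0) t0)) _.
by rewrite -scalerA -scalerDr (sublinearZ _ sp (ltW c0)); lra.
Qed.

Lemma tilt_le_self v : tilt p f v <= p v.
Proof. by have := tilt_le v (lexx 0); rewrite scale0r addr0 mul0r subr0. Qed.

Lemma tilt_opp : tilt p f (- f) <= - p f.
Proof.
by have := tilt_le (- f) ler01; rewrite scale1r addNr sublinear0 // mul1r sub0r.
Qed.

End Tilt.

(** An odd sublinear functional is additive, since subadditivity at [- u] and [- v] reverses the
    inequality; oddness comes from tilting. *)
Lemma minimal_sublinear_linear p : sublinear p ->
  (forall q, sublinear q -> (forall v, q v <= p v) -> q = p) -> linear_form p.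
Proof.
move=> sp pmin.
have pN u : p (- u) = - p u.
  have tE := pmin _ (tilt_sublinear u sp) (tilt_le_self u sp).
  apply/eqP; rewrite eq_le; apply/andP; split.
    by have := tilt_opp u sp; rewrite tE.
  by have := sublinearN u sp; lra.
split=> [u v|c u].
  apply/eqP; rewrite eq_le sp.1 /=.
  by have := sp.1 (- u) (- v); rewrite -opprD !pN; lra.
have [c0|c0] := leP 0 c; first exact: sublinearZ.
by rewrite -[c]opprK scaleNr pN sublinearZ ?mulNr // oppr_ge0 ltW.
Qed.

Lemma exists_dominated_linear_form p f : sublinear p ->
  exists phi, [/\ linear_form phi, forall v, phi v <= p v & phi f = p f].
Proof.
move=> sp; have st := tilt_sublinear f sp.
(* With no invariance imposed, [phi] is minimal among all sublinear functionals, hence linear. *)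
have [|phi [sphi _ phit phimin]] := @exists_minimal_sublinear set0 _ st; first by [].
have lphi : linear_form phi.
  by apply: minimal_sublinear_linear => // q sq qphi; exact: phimin.
have phip v : phi v <= p v by apply: le_trans (phit v) (tilt_le_self f sp v).
exists phi; split => //; apply/eqP; rewrite eq_le phip /=.
by have := le_trans (phit (- f)) (tilt_opp f sp); rewrite linear_formN // lerN2.
Qed.

End SublinearFunctionals.

(** * Compactness and continuous real functions *)

Lemma compact_finite_cover (X : topologicalType) (A : set X) (I : choiceType)
    (f : I -> set X) : compact A -> (forall i, open (f i)) ->
  (forall x, A x -> exists i, f i x) ->
  exists D : {fset I}, forall x, A x -> exists2 i, i \in D & f i x.
Proof.
move=> cA oF cov; have [[x0]|noX] := pselect (inhabited X); last first.
  by exists fset0 => x; case: noX.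
pose Y : ptopologicalType :=
  HB.pack_for ptopologicalType X (isPointed.Build X x0).
have : @compact Y A by [].
rewrite compact_cover => /(_ I setT f) [||D _ DX].
- by move=> i _; exact: oF.
- by move=> x Ax; have [i fx] := cov x Ax; exists i.
by exists D => x Ax; have [i] := DX x Ax; exists i.
Qed.

(** The chain is a filter base; a cluster point lies in every member because the members are
    closed. *)
Lemma compact_chain (X : topologicalType) (K : set X) (A : set (set X)) :
  compact K -> A !=set0 -> total_on A subset ->
  (forall Y, A Y -> [/\ closed Y, Y `<=` K & Y !=set0]) ->
  exists x, forall Y, A Y -> Y x.
Proof.
move=> cK [Y0 AY0] totA PA.
have FF : ProperFilter (filter_from A id).
  apply: filter_from_proper; last by move=> Y /PA[].
  apply: filter_from_filter; first by exists Y0.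
  move=> Y Z AY AZ; have [YZ|ZY] := totA _ _ AY AZ.
    by exists Y => // x Yx; split => //; exact: YZ.
  by exists Z => // x Zx; split => //; exact: ZY.
have [|x [Kx xF]] := cK (filter_from A id) FF.
  by exists Y0 => //; have [] := PA _ AY0.
exists x => Y AY; have [clY _ _] := PA _ AY; apply: clY => B Bx.
by apply: xF => //; exists Y.
Qed.

Section RealValuedFunctions.
Variable T : topologicalType.
Implicit Types f g : T -> RR.

Lemma continuousRD f g : continuous f -> continuous g ->
  continuous (fun x => f x + g x).
Proof. by move=> cf cg x; apply: (@cvgD RR RR^o); [exact: cf|exact: cg]. Qed.

Lemma continuousRM (c : RR) f : continuous f -> continuous (fun x => c * f x).
Proof. by move=> cf x; apply: (@cvgMr RR T); exact: cf. Qed.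

Lemma continuousR_norm f : continuous f -> continuous (fun x => `|f x|).
Proof. by move=> cf x; apply: (@cvg_norm RR RR^o); exact: cf. Qed.

Lemma continuousR_cst (c : RR) : continuous (fun _ : T => c).
Proof. by move=> x; exact: cvg_cst. Qed.

Lemma continuousRB f g : continuous f -> continuous g ->
  continuous (fun x => f x - g x).
Proof.
move=> cf cg; rewrite (_ : (fun x => _) = (fun x => f x + (-1) * g x)).
  by apply: continuousRD => //; exact: continuousRM.
by apply/funext => x; rewrite mulN1r.
Qed.

Lemma continuousR_sum (I : Type) (r : seq I) (F : I -> T -> RR) :
  (forall i, continuous (F i)) -> continuous (fun x => \sum_(i <- r) F i x).
Proof.
move=> cF; elim: r => [|i r IH].
  rewrite (_ : (fun x => _) = (fun=> 0)); first exact: continuousR_cst.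
  by apply/funext => x; rewrite big_nil.
rewrite (_ : (fun x => _) = (fun x => F i x + \sum_(j <- r) F j x)).
  exact: continuousRD.
by apply/funext => x; rewrite big_cons.
Qed.

Lemma closedR_ge f (c : RR) : continuous f -> closed [set x | c <= f x].
Proof.
move=> cf; apply: (@closed_comp _ RR f [set y | c <= y]); first by move=> x _; exact: cf.
exact: (@closed_ge RR).
Qed.

Lemma closedR_le f g : continuous f -> continuous g ->
  closed [set x | f x <= g x].
Proof.
move=> cf cg; rewrite (_ : [set x | _] = [set x | 0 <= g x - f x]).
  by apply: closedR_ge; exact: continuousRB.
by apply/funext => x /=; rewrite subr_ge0.
Qed.

Lemma closedR_eq f g : continuous f -> continuous g ->
  closed [set x | f x = g x].
Proof.
move=> cf cg; rewrite (_ : [set x | _] = [set x | f x <= g x] `&` [set x | g x <= f x]).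
  by apply: closedI; exact: closedR_le.
apply/seteqP; split => x /=; first by move=> ->.
by move=> [fg gf]; apply/eqP; rewrite eq_le fg gf.
Qed.

Lemma openR_lt f (c : RR) : continuous f -> open [set x | f x < c].
Proof.
move=> cf; rewrite (_ : [set x | _] = ~` [set x | c <= f x]).
  by apply: closed_openC; exact: closedR_ge.
by apply/seteqP; split => x /=; rewrite leNgt; [move=> ->|move/negP/negPn].
Qed.

Lemma compactR_max f (A : set T) : continuous f -> compact A -> A !=set0 ->
  exists2 x, A x & forall y, A y -> f y <= f x.
Proof.
move=> cf cA A0.
have [|x /set_mem Ax xmax] := @compact_EVT_max T RR f A A0 cA.
  by apply: continuous_subspaceT.
by exists x => // y Ay; apply: xmax; exact: mem_set.
Qed.

End RealValuedFunctions.

Lemma compact_set_type (X : topologicalType) (A : set X) :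
  compact A -> compact [set: A].
Proof.
move=> cA F FF _.
have [|x [Ax xF]] := cA (fmap set_val F) _.
  apply: (@filterS _ F _ setT) => [y _ /=|]; last exact: filterT.
  exact: set_valP.
exists (exist _ x (mem_set Ax)); split => // B C FB [U [[W oW <-] Wx WC]].
have Wx' : nbhs x W by exact: open_nbhs_nbhs.
have FB' : fmap set_val F (set_val @` B).
  by apply: (@filterS _ F _ B) FB => y By; exists y.
have [_ [[y By <-] Wy]] := xF _ _ FB' Wx'.
by exists y; split => //; exact: WC.
Qed.

Lemma hausdorff_set_type (X : topologicalType) (A : set X) :
  hausdorff_space X -> hausdorff_space A.
Proof.
move=> hX x y xy; apply: val_inj; apply: hX => B C Bx Cy.
have cv := @initial_continuous A X set_val.
have [z [Bz Cz]] := xy _ _ (cv x B Bx) (cv y C Cy).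
by exists (set_val z).
Qed.

(** * Monotonicity of states and their translates *)

Section States.
Variables (X : topologicalType) (nu : (X -> RR) -> RR).
Implicit Types f h : X -> RR.
Hypothesis nuS : state nu.

Lemma state_cst c : nu (fun=> c) = c.
Proof.
have [_ nuZ _ nu1] := nuS; have := nuZ c _ (@continuousR_cst X 1).
by rewrite nu1 mulr1.
Qed.

Lemma state_sub f h : continuous f -> continuous h ->
  nu (fun x => f x - h x) = nu f - nu h.
Proof.
have [nuD nuZ _ _] := nuS => cf ch.
rewrite (_ : (fun x => _) = (fun x => f x + (-1) * h x)); last first.
  by apply/funext => x; rewrite mulN1r.
by rewrite nuD ?nuZ ?mulN1r //; exact: continuousRM.
Qed.

Lemma state_le f h : continuous f -> continuous h -> (forall x, f x <= h x) ->
  nu f <= nu h.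
Proof.
move=> cf ch fh; rewrite -subr_ge0 -state_sub //; have [_ _ nu0 _] := nuS.
by apply: nu0 => [|x]; [exact: continuousRB|rewrite subr_ge0].
Qed.

Lemma state_norm_le f h : continuous f -> continuous h ->
  (forall x, `|f x| <= h x) -> `|nu f| <= nu h.
Proof.
move=> cf ch fh; rewrite ler_norml; apply/andP; split.
  have <- : nu (fun x => (-1) * h x) = - nu h.
    by have [_ nuZ _ _] := nuS; rewrite nuZ // mulN1r.
  apply: state_le => //; first exact: continuousRM.
  by move=> x; rewrite mulN1r lerNl; apply: le_trans (fh x); rewrite -normrN ler_norm.
by apply: state_le => // x; apply: le_trans (fh x); exact: ler_norm.
Qed.

End States.

Lemma translate_state_state (G : groupType) (X : topologicalType)
    (act : G -> X -> X) g nu : is_continuous_action act -> state nu ->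
  state (translate_state act g nu).
Proof.
move=> [ca _ _] [nuD nuZ nu0 nu1].
have cc (f : X -> RR) : continuous f -> continuous (fun y => f (act g y)).
  by move=> cf y; apply: (@continuous_comp _ _ _ (act g) f); [exact: ca|exact: cf].
split => //.
- by move=> f h cf ch; apply: nuD; exact: cc.
- by move=> c f cf; apply: nuZ; exact: cc.
- by move=> f cf f0; apply: nu0 => //; exact: cc.
Qed.

(** * Norming sets of dominated forms in the weak* topology *)

Section NormingSets.
Variables (V : lmodType RR) (p : V -> RR).
Hypothesis sp : sublinear p.
Local Notation W := {ptws V -> RR}.

Lemma eval_continuous (v : V) : continuous (fun phi : W => phi v).
Proof. exact: (@proj_continuous V (fun=> RR)). Qed.

Definition dominated : set W :=
  [set phi | linear_form phi /\ forall v, phi v <= p v].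

Lemma dominated_closed : closed dominated.
Proof.
rewrite (_ : dominated =
    (\bigcap_(uv in [set: V * V])
      [set phi : W | phi (uv.1 + uv.2) = phi uv.1 + phi uv.2])
    `&` ((\bigcap_(cu in [set: RR * V])
      [set phi : W | phi (cu.1 *: cu.2) = cu.1 * phi cu.2])
    `&` (\bigcap_(v in [set: V]) [set phi : W | phi v <= p v]))); last first.
  apply/seteqP; split => phi.
    move=> [[pD pZ] pp]; split=> [[u v] _|]; first exact: pD.
    by split=> [[c u] _|v _]; [exact: pZ|exact: pp].
  move=> [pD [pZ pp]]; split; last by move=> v; exact: (pp v).
  by split => [u v|c u]; [exact: (pD (u, v))|exact: (pZ (c, u))].
have ev := eval_continuous.
apply: closedI; last apply: closedI.
- apply: closed_bigI => -[u v] _ /=; apply: closedR_eq => //.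
  exact: continuousRD.
- apply: closed_bigI => -[c u] _ /=; apply: closedR_eq => //.
  exact: continuousRM.
- by apply: closed_bigI => v _; apply: closedR_le => //; exact: continuousR_cst.
Qed.

(** Banach-Alaoglu: [phi v] is confined to the segment from [- p (- v)] to [p v], so Tychonoff
    applies. *)
Lemma dominated_compact : compact dominated.
Proof.
apply: (@subclosed_compact _ _
  [set phi : W | forall v, [set` `[- p (- v), p v]] (phi v)]).
- exact: dominated_closed.
- apply: (@tychonoff V (fun=> RR) (fun v => [set` `[- p (- v), p v]])) => v.
  exact: (@segment_compact RR).
- move=> phi [lphi phip] v /=; rewrite in_itv /= phip andbT.
  by have := phip (- v); rewrite (linear_formN _ lphi); lra.
Qed.

(** These are the closed subsets of [dominated] with support function [p]. By Milman's theorem the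
    least one is the closure of the extreme points of [dominated]. *)
Definition norming (Y : set W) :=
  [/\ closed Y, Y `<=` dominated & forall f, exists2 y, Y y & y f = p f].

Lemma norming_dominated : norming dominated.
Proof.
split => //; first exact: dominated_closed.
move=> f; have [phi [lphi phip phif]] := exists_dominated_linear_form f sp.
by exists phi.
Qed.

Lemma norming_compact Y : norming Y -> compact Y.
Proof. by move=> [cY YK _]; exact: subclosed_compact dominated_compact YK. Qed.

(** For fixed [f], the members cut by [E] form a chain of nonempty closed subsets of a compact set,
    so one form attains [p f] in all of them. *)
Lemma norming_chain (A : set (set W)) : A !=set0 -> total_on A subset ->
  (forall Y, A Y -> norming Y) -> norming (\bigcap_(Y in A) Y).
Proof.
move=> [Y0 AY0] totA nA; split.
- by apply: closed_bigI => Y /nA[].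
- by move=> y /(_ _ AY0); have [_ YK _] := nA _ AY0; exact: YK.
move=> f; pose E := [set y : W | y f = p f].
have clE : closed E.
  by apply: closedR_eq; [exact: eval_continuous|exact: continuousR_cst].
have [|_ _ [Y AY <-] [Z AZ <-]|_ [Y AY <-]|y Hy] :=
    @compact_chain W dominated [set Y `&` E | Y in A] dominated_compact.
- by exists (Y0 `&` E), Y0.
- by have [YZ|ZY] := totA _ _ AY AZ; [left|right]; exact: setSI.
- have [cY YK Ef] := nA _ AY; split; first exact: closedI.
    by move=> y [/YK].
  by have [y Yy yf] := Ef f; exists y.
exists y => [Y AY|]; first by have [] := Hy (Y `&` E) (ex_intro2 _ _ _ AY erefl).
by have [] := Hy (Y0 `&` E) (ex_intro2 _ _ _ AY0 erefl).
Qed.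

Lemma exists_minimal_norming :
  exists2 X, norming X & forall Z, norming Z -> Z `<=` X -> Z = X.
Proof.
pose D := {Y | norming Y}.
pose R (Y Z : D) := `[< sval Z `<=` sval Y >].
have [||||[X nX] Xmin] := @Zorn D R.
- by move=> Y; apply/asboolP.
- by move=> Y Z Q /asboolP YZ /asboolP ZQ; apply/asboolP; exact: subset_trans YZ.
- move=> [Y nY] [Z nZ] /asboolP YZ /asboolP ZY; apply: eq_exist.
  by apply/seteqP.
- move=> A totA; have [[Y0 AY0]|A0] := pselect (exists Y : D, A Y); last first.
    by exists (exist _ dominated norming_dominated) => Y AY; case: A0; exists Y.
  have nI : norming (\bigcap_(Y in [set sval (Z : D) | Z in A]) Y).
    apply: norming_chain; first by exists (sval Y0), Y0.
      move=> _ _ [Y AY <-] [Z AZ <-].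
      by have [/asboolP|/asboolP] := totA _ _ AY AZ; [right|left].
    by move=> _ [Y AY <-]; exact: (svalP Y).
  exists (exist _ _ nI : D) => Y AY; apply/asboolP => y /= Hy.
  by apply: (Hy (sval Y)); exists Y.
exists X => // Z nZ ZX.
by have := Xmin (exist _ Z nZ); move=> /(_ (asboolT ZX)) [].
Qed.

Section MinimalNorming.
Variable X : set W.
Hypothesis nX : norming X.
Hypothesis Xmin : forall Z, norming Z -> Z `<=` X -> Z = X.

(** If every [f] attained [p f] off [U], then [X] minus [U] would be a smaller norming set.
    Compactness of that remainder turns strict inequality into a gap [c]. *)
Lemma minimal_norming_peak (U : set W) (x : W) : open U -> U x -> X x ->
  exists (f : V) (c : RR), 0 < c /\ forall y, X y -> ~ U y -> y f <= p f - c.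
Proof.
move=> oU Ux Xx; have [cX XK Xf] := nX.
pose Z := X `&` ~` U.
have cZ : closed Z by apply: closedI => //; exact: open_closedC.
have [f Hf] : exists f, forall y, Z y -> y f <> p f.
  apply: contrapT => /forallNP h.
  have nZ : norming Z.
    split => //; first by move=> y [/XK].
    move=> f; have /existsNP[y /not_implyP[Zy /contrapT yf]] := h f.
    by exists y.
  have : Z x by rewrite (Xmin nZ) // => y [].
  by case.
have [Z0|/set0P/negP/negPn/eqP Z0] := pselect (Z !=set0); last first.
  exists f, 1; split => // y Xy Uy; have : Z y by [].
  by rewrite Z0.
have compZ : compact Z.
  by apply: subclosed_compact dominated_compact _ => // y [/XK].
have [z Zz zmax] := compactR_max (@eval_continuous f) compZ Z0.
exists f, (p f - z f); split.
  have [/XK [_ /(_ f) zp] _] := Zz.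
  by rewrite subr_gt0 lt_neqAle zp andbT; apply/eqP; exact: Hf.
by move=> y Xy Uy; have := zmax y (conj Xy Uy); lra.
Qed.

(* If [f] peaks near [x] and [y] in [Y] has [y f = p f], then comparing [h] with
   [h + t *: f] for [t] large shows that [y h] cannot exceed the values of [h]
   near [x]; so [y] lies in any prescribed convex neighbourhood of [x]. *)
Lemma minimal_norming_least (Y : set W) : norming Y -> X `<=` Y.
Proof.
move=> nY x Xx; apply: contrapT => Yx.
have [cX XK Xf] := nX; have [cY YK Yf] := nY.
have [lx xp] := XK _ Xx.
have ev := eval_continuous.
have [||D covD] := @compact_finite_cover W Y V (fun h => [set y : W | x h + 1 < y h])
    (norming_compact nY).
- move=> h; rewrite (_ : [set y | _] = [set y | - 1 * y h < - (x h + 1)]).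
    by apply: openR_lt; exact: continuousRM.
  by apply/funext => y /=; rewrite mulN1r ltrN2.
- move=> y Yy; have [h yh] : exists h, y h <> x h.
    apply: contrapT => /forallNP h; apply: Yx; rewrite (_ : x = y) //.
    by apply/funext => v; apply: contrapT => xy; apply: (h v) => yx; exact: xy.
  have [ly yp] := YK _ Yy.
  (* Rescaling makes the difference of [y] and [x] equal to 2, beyond the threshold 1 of the
     cover. *)
  exists ((2 / (y h - x h)) *: h) => /=; rewrite lx.2 ly.2.
  have d0 : y h - x h != 0 by rewrite subr_eq0; apply/eqP.
  have : 2 / (y h - x h) * (y h - x h) = 2 by rewrite divfK.
  by rewrite mulrBr; lra.
(* [U] is a neighbourhood of [x] avoiding the finitely many half-spaces that cover [Y]. *)
pose U := ~` (\bigcup_(h in [set` D]) [set y : W | x h + 1 <= y h]).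
have oU : open U.
  apply: closed_openC; apply: closed_bigcup => [|h _]; first exact: finite_fset.
  exact: closedR_ge.
have Ux : U x by move=> [h _ /=]; lra.
have [f [c [c0 Hf]]] := minimal_norming_peak oU Ux Xx.
have [y Yy yf] := Yf f; have [h Dh hy] := covD y Yy.
have [ly yp] := YK _ Yy.
(* Off [U], the loss [t * c] from missing the peak of [f] outweighs any gain of [h] over
   [x h + 1]. *)
pose t : RR := `|p h - x h - 1| / c.
have t0 : 0 <= t by rewrite divr_ge0 // ltW.
have tc : p h - x h - 1 <= t * c by rewrite divfK ?gt_eqF // ler_norm.
have [z Xz zE] := Xf (h + t *: f); have [lz zp] := XK _ Xz.
have := yp (h + t *: f); rewrite -zE lz.1 lz.2 ly.1 ly.2 yf.
suff : z h + t * z f <= x h + 1 + t * p f by move: hy => /=; lra.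
have [Uz|Uz] := pselect (U z).
  have zh : z h < x h + 1.
    by rewrite ltNge; apply/negP => zh; apply: Uz; exists h.
  have := ler_wpM2l t0 (zp f); lra.
have := ler_wpM2l t0 (Hf z Xz Uz); have := zp h; rewrite mulrBr; lra.
Qed.

End MinimalNorming.
End NormingSets.

(** * The minimal norming set as a boundary *)

Section BoundaryOfLinearAction.
Variables (G : groupType) (V : lmodType RR) (a : G -> V -> V).
Hypothesis a1 : forall v, a 1%g v = v.
Hypothesis aM : forall g h v, a (g * h)%g v = a g (a h v).
Hypothesis aD : forall g u v, a g (u + v) = a g u + a g v.
Hypothesis aZ : forall g (c : RR) v, a g (c *: v) = c *: a g v.
Local Notation W := {ptws V -> RR}.

Definition dual_act (g : G) (phi : W) : W := fun v => phi (a g^-1%g v).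

Lemma dual_act1 phi : dual_act 1%g phi = phi.
Proof. by apply/funext => v; rewrite /dual_act invg1 a1. Qed.

Lemma dual_actM g h phi : dual_act (g * h)%g phi = dual_act g (dual_act h phi).
Proof. by apply/funext => v; rewrite /dual_act invgM aM. Qed.

Lemma dual_act_continuous g : continuous (dual_act g).
Proof.
move=> phi; apply/cvg_sup => v.
by apply: continuous_comp_initial => psi; exact: eval_continuous.
Qed.

Variable p : V -> RR.
Hypothesis ip : forall g v, p (a g v) = p v.
Hypothesis pmin : forall q, sublinear q -> (forall g v, q (a g v) = q v) ->
  (forall v, q v <= p v) -> q = p.

(* The supremum of a form over an orbit is an invariant sublinear functional
   below [p], hence equals [p]. *)
Lemma orbit_attains (b : V -> RR) f (e : RR) : linear_form b ->
  (forall v, b v <= p v) -> 0 < e -> exists g, p f - e < b (a g f).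
Proof.
move=> lb bp e0.
pose S v := [set b (a g v) | g in [set: G]].
have S0 v : S v !=set0 by exists (b (a 1%g v)), 1%g.
have Sub v : has_ubound (S v) by exists (p v) => _ [g _ <-]; rewrite -(ip g).
have les g v : b (a g v) <= sup (S v) by apply: ub_le_sup => //; exists g.
have qE : (fun v => sup (S v)) = p.
  apply: pmin; first split.
  - move=> u v; apply: ge_sup => // _ [g _ <-].
    by rewrite aD lb.1 lerD.
  - move=> c u c0; apply: ge_sup => // _ [g _ <-].
    by rewrite aZ lb.2 ler_pM2l.
  - move=> g v; congr sup; apply/seteqP; split => _ [h _ <-].
      by exists (h * g)%g; rewrite // aM.
    by exists (h * g^-1)%g; rewrite // -aM mulgVK.
  - by move=> v; apply: ge_sup => // _ [g _ <-]; rewrite -(ip g).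
apply: contrapT => /forallNP h.
have : sup (S f) <= p f - e.
  by apply: ge_sup => // _ [g _ <-]; rewrite leNgt; apply/negP/h.
by rewrite -[p f](congr1 (@^~ f) qE) /=; lra.
Qed.

Variable X : set W.
Hypothesis nX : norming p X.
Hypothesis Xmin : forall Z, norming p Z -> Z `<=` X -> Z = X.

(** The preimage of [X] under [dual_act g] is norming because [p] is invariant, so it contains the
    least norming set [X]. *)
Lemma dual_act_stable g phi : X phi -> X (dual_act g phi).
Proof.
have [cX XK Xf] := nX.
apply: (@minimal_norming_least _ _ _ nX Xmin [set psi | X (dual_act g psi)]).
split.
- by apply: closed_comp => // psi _; exact: dual_act_continuous.
- move=> psi /= /XK [[lD lZ] lp].
  have E v : psi v = dual_act g psi (a g v) by rewrite /dual_act -aM mulVg a1.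
  split; last by move=> v; rewrite E -(ip g v).
  by split => [u v|c v]; rewrite !E ?aD ?aZ ?lD ?lZ.
- move=> f; have [y Xy yf] := Xf (a g f).
  exists (dual_act g^-1%g y) => /=.
    by rewrite -dual_actM mulgV dual_act1.
  by rewrite /dual_act invgK yf ip.
Qed.

Definition boundary_act (g : G) (y : X) : X :=
  exist _ (dual_act g (val y)) (mem_set (dual_act_stable g (set_mem (valP y)))).

Definition boundary_eval (f : V) (y : X) : RR := (val y : W) f.

Lemma boundary_val_dominated (y : X) : dominated p (val y).
Proof. by have [_ XK _] := nX; apply: XK; exact: set_mem (valP y). Qed.

Lemma boundary_eval_continuous f : continuous (boundary_eval f).
Proof.
move=> y; apply: (@continuous_comp _ _ _ (set_val : X -> W) (fun phi : W => phi f)).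
  exact: initial_continuous.
exact: eval_continuous.
Qed.

Lemma boundary_act_eval g f y :
  boundary_eval f (boundary_act g y) = boundary_eval (a g^-1%g f) y.
Proof. by []. Qed.

Lemma boundary_is_action : is_continuous_action boundary_act.
Proof.
split.
- move=> g; apply: continuous_comp_initial => y.
  apply: (@continuous_comp _ _ _ (set_val : X -> W) (dual_act g)).
    exact: initial_continuous.
  exact: dual_act_continuous.
- by move=> x; apply: val_inj; rewrite /= dual_act1.
- by move=> g h x; apply: val_inj; rewrite /= dual_actM.
Qed.

Lemma boundary_compact : compact_hausdorff_nonempty X.
Proof.
split.
- apply: compact_set_type; exact: norming_compact nX.
- apply: hausdorff_set_type; apply: (@hausdorff_product V (fun=> RR)) => _.
  exact: (@Rhausdorff RR).
- have [_ _ /(_ 0) [y Xy _]] := nX.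
  by exists (exist _ y (mem_set Xy)).
Qed.

Lemma boundary_peak (U : set X) (x : X) : open U -> U x ->
  exists (f : V) (c : RR),
    0 < c /\ forall y, ~ U y -> boundary_eval f y <= p f - c.
Proof.
move=> [W' oW' <-] Ux.
have [f [c [c0 Hf]]] := minimal_norming_peak nX Xmin oW' Ux (set_mem (valP x)).
by exists f, c; split => // y Uy; apply: Hf => //; exact: set_mem (valP y).
Qed.

(** Take [f] peaking inside a given open set: some translate of [x] takes a value above [p f - c] at
    [f], so it lies in that set. *)
Lemma boundary_minimal : minimal_action boundary_act.
Proof.
move=> x; apply/seteqP; split => // y _ B.
rewrite nbhsE => -[U [oU Uy] UB].
have [f [c [c0 Hf]]] := boundary_peak oU Uy.
have [lx xp] := boundary_val_dominated x.
have [g Hg] := orbit_attains f lx xp c0.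
exists (boundary_act g^-1%g x); split; first by exists g^-1%g.
apply: UB; apply: contrapT => /Hf.
by rewrite boundary_act_eval invgK /boundary_eval; lra.
Qed.

(** With [f] peaking where [H < e / 2], the function [H] is at most [e / 2 + k * (p f - f)] on [X].
    A translate of [nu] whose value at [f] is close to [p f] makes the right side small. *)
Lemma state_concentrates nu (x : X) (H : X -> RR) (e : RR) : state nu ->
  continuous H -> H x = 0 -> 0 < e ->
  exists g, translate_state boundary_act g nu H < e.
Proof.
move=> nuS cH Hx e0.
have [f [c [c0 Hf]]] : exists (f : V) (c : RR), 0 < c /\
    forall y, ~ [set y | H y < e / 2] y -> boundary_eval f y <= p f - c.
  by apply: (@boundary_peak _ x); [exact: openR_lt|rewrite /= Hx; lra].
have [cX _ _] := boundary_compact.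
have [m _ Hm] := compactR_max cH cX (ex_intro _ x Logic.I).
have m0 : 0 <= H m by rewrite -Hx Hm.
(* Off the peak region [p f - f] is at least [c], so this slope lifts the bound above the maximum of
   [H]. *)
pose k := (H m + 1) / c.
have k0 : 0 < k by rewrite divr_gt0 //; lra.
have kc : k * c = H m + 1 by rewrite divfK ?gt_eqF.
have cev := boundary_eval_continuous.
have lb : linear_form (fun v => nu (boundary_eval v)).
  have [nuD nuZ _ _] := nuS.
  split => [u v|r v].
    rewrite -nuD //; congr nu; apply/funext => y.
    exact: (boundary_val_dominated y).1.1.
  rewrite -nuZ //; congr nu; apply/funext => y.
  exact: (boundary_val_dominated y).1.2.
have bp v : nu (boundary_eval v) <= p v.
  rewrite -[leRHS](state_cst nuS); apply: state_le => //; first exact: continuousR_cst.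
  by move=> y; exact: (boundary_val_dominated y).2.
(* Multiplied by [k], this tolerance becomes the remaining [e / 2]. *)
have ek : 0 < e / 2 / k by rewrite divr_gt0 //; lra.
have [g Hg] := orbit_attains f lb bp ek.
exists g^-1%g; set nu' := translate_state _ _ _.
have nuS' : state nu' by apply: translate_state_state => //; exact: boundary_is_action.
have nu'f : nu' (boundary_eval f) = nu (boundary_eval (a g f)).
  rewrite /nu' /translate_state; congr nu; apply/funext => y.
  by rewrite boundary_act_eval invgK.
pose F y := e / 2 + k * p f - k * boundary_eval f y.
have HF : nu' H <= nu' F.
  apply: state_le => //.
    by apply: continuousRB; [exact: continuousR_cst|exact: continuousRM].
  move=> y; rewrite /F; have [_ /(_ f) yp] := boundary_val_dominated y.
  have [He|He] := pselect (H y < e / 2).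
    by have := ler_wpM2l (ltW k0) yp; rewrite /boundary_eval; lra.
  have := ler_wpM2l (ltW k0) (Hf y He); rewrite mulrBr kc.
  by have := Hm y Logic.I; lra.
apply: le_lt_trans HF _.
rewrite /F state_sub //; [|exact: continuousR_cst|exact: continuousRM].
have [_ nuZ' _ _] := nuS'; rewrite state_cst // nuZ' // nu'f.
have : k * (p f - e / 2 / k) < k * nu (boundary_eval (a g f)) by rewrite ltr_pM2l.
by rewrite mulrBr [k * (_ / k)]mulrC divfK ?gt_eqF //; lra.
Qed.

Lemma boundary_strongly_proximal : strongly_proximal boundary_act.
Proof.
move=> nu nuS; have [_ _ [x _]] := boundary_compact.
exists x => n fs e e0 cfs.
(* One function vanishing at [x] dominates all the test deviations, so a single [g] handles every
   [i]. *)
pose H y : RR := \sum_(i < n) `|fs i y - fs i x|.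
have cd i : continuous (fun y => fs i y - fs i x).
  by apply: continuousRB => //; exact: continuousR_cst.
have cH : continuous H.
  by apply: continuousR_sum => i; apply: continuousR_norm; exact: cd.
have Hx : H x = 0 by rewrite /H big1 // => i _; rewrite subrr normr0.
have [g Hg] := state_concentrates nuS cH Hx e0.
exists g => i; apply: le_lt_trans Hg.
have nuS' := translate_state_state g boundary_is_action nuS.
rewrite -[X in _ - X](state_cst nuS') -state_sub //; last exact: continuousR_cst.
apply: state_norm_le => // y.
by rewrite /H (bigD1 i) //= lerDl sumr_ge0.
Qed.

Lemma boundary_G_boundary : G_boundary boundary_act.
Proof.
split; [exact: boundary_is_action|exact: boundary_compact|
  exact: boundary_minimal|exact: boundary_strongly_proximal].
Qed.

(** A one-point norming set forces its only form to equal [p], which is invariant. *)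
Lemma singleton_boundary_invariant (x : X) : (forall y : X, y = x) ->
  forall g v, (val x : W) (a g v) = (val x : W) v.
Proof.
move=> sX; have [_ _ Xf] := nX.
have E v : (val x : W) v = p v.
  have [y Xy <-] := Xf v.
  by have := sX (exist _ y (mem_set Xy)); move=> /(congr1 val) /= ->.
by move=> g v; rewrite !E ip.
Qed.

End BoundaryOfLinearAction.

(** For bounded functions on [G] and [p0] the supremum, the first alternative is an invariant
    mean. *)
Theorem nontrivial_boundary_or_invariant_form (G : groupType) (V : lmodType RR)
    (a : G -> V -> V) (p0 : V -> RR) :
  (forall v, a 1%g v = v) -> (forall g h v, a (g * h)%g v = a g (a h v)) ->
  (forall g u v, a g (u + v) = a g u + a g v) ->
  (forall g (c : RR) v, a g (c *: v) = c *: a g v) ->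
  sublinear p0 -> (forall g v, p0 (a g v) = p0 v) ->
  (exists phi, [/\ linear_form phi, forall v, phi v <= p0 v &
     forall g v, phi (a g v) = phi v]) \/
  (exists (Y : topologicalType) (actY : G -> Y -> Y) (y z : Y),
     G_boundary actY /\ y <> z).
Proof.
move=> a1 aM aD aZ sp0 ip0.
have [_ [g _ <-] v|p [sp ip pp0 pmin]] :=
  @exists_minimal_sublinear V [set a g | g in [set: G]] p0 sp0; first exact: ip0.
have ip' g v : p (a g v) = p v by apply: ip; exists g.
have pmin' q : sublinear q -> (forall g v, q (a g v) = q v) ->
    (forall v, q v <= p v) -> q = p.
  by move=> sq iq qp; apply: pmin => // _ [g _ <-].
have [X nX Xmin] := exists_minimal_norming sp.
have bX := boundary_G_boundary a1 aM aD aZ ip' pmin' nX Xmin.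
have [_ [_ _ [x _]] _ _] := bX.
have [sX|] := pselect (forall y : X, y = x); last first.
  move=> /existsNP[y yx]; right.
  by exists X, (boundary_act a1 aM aD aZ ip' nX Xmin), y, x.
left; exists (val x); have [lx xp] := boundary_val_dominated nX x; split => //.
  by move=> v; apply: le_trans (xp v) (pp0 v).
exact: (singleton_boundary_invariant ip' nX sX).
Qed.

(** * Bounded functions, invariant means and amenability *)

Section BoundedFunctions.
Variable G : groupType.

(** [RR^o] is [RR] as a module over itself, which makes the functions on [G] a module over [RR]. *)
Definition bounded_pred : {pred G -> RR^o} :=
  fun f => `[< exists M : RR, forall x, `|f x| <= M >].

Lemma bounded_submod_closed : submod_closed bounded_pred.
Proof.
split; first by apply/asboolP; exists 0 => x; rewrite normr0.
move=> c f h /asboolP[M fM] /asboolP[N hN]; apply/asboolP.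
exists (`|c| * M + N) => x.
apply: le_trans (ler_normD _ _) _; apply: lerD => //.
by rewrite normrM ler_wpM2l.
Qed.

HB.instance Definition _ :=
  GRing.isSubmodClosed.Build RR (G -> RR^o) bounded_pred bounded_submod_closed.

Record bounded_fun := BoundedFun {
  bounded_val :> G -> RR^o;
  bounded_valP : bounded_val \in bounded_pred }.

HB.instance Definition _ := [isSub for bounded_val].
HB.instance Definition _ := [Choice of bounded_fun by <:].
HB.instance Definition _ := [SubChoice_isSubLmodule of bounded_fun by <:].

Lemma bounded_translate_subproof (g : G) (f : bounded_fun) :
  (fun x => f (g^-1 * x)%g) \in bounded_pred.
Proof.
by have /asboolP[M fM] := bounded_valP f; apply/asboolP; exists M.
Qed.

Definition bounded_translate (g : G) (f : bounded_fun) : bounded_fun :=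
  BoundedFun (bounded_translate_subproof g f).

Lemma bounded_indicator_subproof (A : set G) :
  (fun x => (x \in A)%:R : RR) \in bounded_pred.
Proof.
by apply/asboolP; exists 1 => x; case: (x \in A); rewrite ?normr1 ?normr0.
Qed.

Definition bounded_indicator (A : set G) : bounded_fun :=
  BoundedFun (bounded_indicator_subproof A).

Lemma bounded_funP (f h : bounded_fun) : (forall x, f x = h x) -> f = h.
Proof. by move=> fh; apply: val_inj; apply/funext. Qed.

Definition bounded_sup (f : bounded_fun) : RR := sup (range f).

Lemma le_bounded_sup (f : bounded_fun) x : f x <= bounded_sup f.
Proof.
apply: ub_le_sup; last by exists x.
have /asboolP[M fM] := bounded_valP f.
by exists M => _ [y _ <-]; apply: le_trans (fM y); exact: ler_norm.
Qed.

Lemma bounded_sup_le (f : bounded_fun) c : (forall x, f x <= c) ->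
  bounded_sup f <= c.
Proof.
by move=> fc; apply: ge_sup => [|_ [y _ <-]//]; exists (f 1%g), 1%g.
Qed.

Lemma bounded_sup_sublinear : sublinear (V := bounded_fun) bounded_sup.
Proof.
split=> [f h|c f c0]; apply: bounded_sup_le => x.
  by apply: lerD; exact: le_bounded_sup.
by apply: ler_wpM2l; [exact: ltW|exact: le_bounded_sup].
Qed.

Lemma bounded_sup_translate g f : bounded_sup (bounded_translate g f) = bounded_sup f.
Proof.
apply/eqP; rewrite eq_le; apply/andP; split; apply: bounded_sup_le => x.
  exact: (le_bounded_sup f (g^-1 * x)%g).
by have := le_bounded_sup (bounded_translate g f) (g * x)%g; rewrite /= mulKg.
Qed.

(** The upper bound applied to [- f] yields a lower bound by the infimum, so [phi] is positive and
    normalised; its values on indicators give the invariant measure. *)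
Lemma amenable_of_invariant_form (phi : bounded_fun -> RR) :
  linear_form phi -> (forall f, phi f <= bounded_sup f) ->
  (forall g f, phi (bounded_translate g f) = phi f) -> amenable G.
Proof.
move=> lphi phis iphi.
have phi_ge (f : bounded_fun) (c : RR) : (forall x, c <= f x) -> c <= phi f.
  move=> cf; have := phis (- f); rewrite linear_formN // => phif.
  suff : bounded_sup (- f) <= - c by lra.
  by apply: bounded_sup_le => x; rewrite lerN2.
exists (fun A => phi (bounded_indicator A)); split.
- by move=> A; apply: phi_ge => x /=.
- apply/eqP; rewrite eq_le; apply/andP; split.
    by apply: le_trans (phis _) _; apply: bounded_sup_le => x /=; rewrite in_setT.
  by apply: phi_ge => x /=; rewrite in_setT.
- move=> A B AB; rewrite -lphi.1; congr phi; apply: bounded_funP => x /=.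
  rewrite -[RHS]/((x \in A)%:R + (x \in B)%:R : RR) in_setU.
  have [/set_mem Ax|_] := boolP (x \in A); last by rewrite add0r.
  have -> : (x \in B) = false; last by rewrite addr0.
  by apply/negP => /set_mem Bx; have : (A `&` B) x by []; rewrite AB.
- move=> g A; rewrite -[RHS](iphi g); congr phi; apply: bounded_funP => x /=.
  congr (_%:R); congr nat_of_bool; apply/idP/idP => /set_mem.
    by move=> [y Ay <-]; rewrite mulKg; exact: mem_set.
  by move=> Ax; apply: mem_set; exists (g^-1 * x)%g; rewrite ?mulVKg.
Qed.

End BoundedFunctions.

Theorem nonamenable_nontrivial_boundary (G : groupType) : ~ amenable G ->
  exists (Y : topologicalType) (actY : G -> Y -> Y) (y z : Y),
    G_boundary actY /\ y <> z.
Proof.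
move=> namG.
have [||||||[phi [lphi phis iphi]]|//] := @nontrivial_boundary_or_invariant_form
  G (bounded_fun G) (@bounded_translate G) (@bounded_sup G).
- by move=> f; apply: bounded_funP => x /=; rewrite invg1 mul1g.
- by move=> g h f; apply: bounded_funP => x /=; rewrite invgM mulgA.
- by move=> g f h; apply: bounded_funP.
- by move=> g c f; apply: bounded_funP.
- exact: bounded_sup_sublinear.
- exact: bounded_sup_translate.
by case: namG; exact: amenable_of_invariant_form lphi phis iphi.
Qed.

(** * Infinite groups whose proper nontrivial subgroups all have [p] elements *)

Section SubgroupsOfBoundedOrder.
Variables (G : groupType) (p : nat).
Hypothesis infG : ~ finite_set [set: G].
Hypothesis card_proper : forall H : set G, is_subgroup H -> H <> [set 1%g] ->
  H <> setT -> (H #= `I_p)%card.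

(** Both subgroups are proper and nontrivial, so the inclusion is between sets of [p] elements. *)
Lemma subgroup_eq (H K : set G) : is_subgroup H -> is_subgroup K ->
  H <> [set 1%g] -> K <> setT -> H `<=` K -> H = K.
Proof.
move=> sH sK H1 KT HK.
have HT : H <> setT.
  by move=> HT; apply: KT; apply/seteqP; split => // x _; apply: HK; rewrite HT.
have K1 : K <> [set 1%g].
  move=> K1; apply: H1; rewrite -K1; apply/seteqP; split => // x; rewrite K1 => ->.
  by case: sH.
have cH := card_proper sH H1 HT; have cK := card_proper sK K1 KT.
have fH : finite_set H by apply/finite_setP; exists p.
have fK : finite_set K by apply/finite_setP; exists p.
rewrite -(fset_setK fH) -(fset_setK fK); suff -> : fset_set H = fset_set K by [].
apply/eqP; rewrite eqEfcard (card_fset_set cH) (card_fset_set cK) leqnn andbT.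
by apply/fsubsetP => x; rewrite !in_fset_set // => /set_mem xH; exact/mem_set/HK.
Qed.

Lemma finite_proper_subgroup (H : set G) : is_subgroup H -> H <> setT ->
  finite_set H.
Proof.
move=> sH HT; have [->|H1] := pselect (H = [set 1%g]); first exact: finite_set1.
by apply/finite_setP; exists p; exact: card_proper.
Qed.

Definition normal_set (S : set G) := forall g x, S x -> S (g * x * g^-1)%g.

(* For [S] normal, the subgroup generated by [S] and [g], written without negative
   powers. *)
Definition adjoin (S : set G) (g : G) : set G :=
  [set x | exists i j : nat, S (g ^+ i * x * (g ^+ j)^-1)%g].

Lemma adjoin_subgroup (S : set G) g : is_subgroup S -> normal_set S ->
  is_subgroup (adjoin S g).
Proof.
move=> [S1 SM SV] nS; split.
- by exists 0, 0; rewrite expg0 invg1 !mulg1.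
- move=> x y [i [j Sx]] [k [l Sy]]; exists (k + i)%N, (j + l)%N.
  (* Conjugating the witnesses by [g ^+ k] and [g ^+ j] leaves only powers of [g] between [x] and
     [y], and these cancel. *)
  have := SM _ _ (nS (g ^+ k)%g _ Sx) (nS (g ^+ j)%g _ Sy).
  congr S; rewrite !expgnDr !invgM.
  have gC : (g ^+ k * g ^+ j = g ^+ j * g ^+ k)%g by rewrite -!expgnDr addnC.
  have mid z : ((g ^+ j)^-1 * ((g ^+ k)^-1 * (g ^+ j * (g ^+ k * z))) = z)%g.
    by rewrite (mulgA (g ^+ j)%g) -gC -mulgA !mulKg.
  by rewrite -!mulgA mid.
- move=> x [i [j Sx]]; exists j, i; move: (SV _ Sx); congr S.
  by rewrite !invgM invgK !mulgA.
Qed.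

Lemma subset_adjoin (S : set G) g : S `<=` adjoin S g.
Proof. by move=> x Sx; exists 0, 0; rewrite expg0 invg1 mul1g mulg1. Qed.

Lemma adjoin_mem (S : set G) g : is_subgroup S -> adjoin S g g.
Proof. by move=> [S1 _ _]; exists 0, 1; rewrite expg0 expg1 mul1g mulgV. Qed.

(** Normality puts each element in a coset of [S] by a power of [g], and the exponent matters only
    modulo [m]. *)
Lemma finite_adjoin (S : set G) g m : is_subgroup S -> normal_set S ->
  finite_set S -> (0 < m)%N -> S (g ^+ m)%g -> finite_set (adjoin S g).
Proof.
move=> [S1 SM SV] nS fS m0 Sgm.
have SX n : S (g ^+ (n * m))%g.
  by elim: n => [|n IH]; rewrite ?mul0n ?expg0 // mulSn expgnDr; exact: SM.
apply: (@sub_finite_set _ _ ((fun sr : G * nat => sr.1 * g ^+ sr.2)%g @` (S `*` `I_m))).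
  move=> x [i [j Sx]].
  (* A natural number congruent to [j - i] modulo [m]. *)
  set n := (i * m.-1 + j)%N.
  have Sxn : S (x * (g ^+ n)^-1)%g.
    have := nS (g ^+ i)^-1%g _ Sx.
    rewrite !mulgA mulVg mul1g invgK => Sxi.
    have := SM _ _ Sxi (SV _ (SX i)); congr S.
    rewrite -!mulgA; congr (_ * _)%g; apply: (@mulIg _ (g ^+ n)%g).
    rewrite mulVg -!mulgA; apply: (@mulgI _ (g ^+ j)%g); rewrite mulVKg mulg1.
    rewrite mulgA; apply: (@mulIg _ (g ^+ (i * m))%g).
    rewrite -!mulgA -expgnDr (_ : (n + i * m = i * m + n)%N); last lia.
    rewrite expgnDr mulKg -!expgnDr; congr (_ ^+ _)%g.
    by rewrite /n; case: m m0 {Sgm SX n Sxi} => // m _; rewrite mulnS; lia.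
  exists ((x * (g ^+ (n %% m))^-1)%g, (n %% m)%N) => /=; last by rewrite mulgVK.
  split => /=; last by rewrite ltn_mod.
  have := SM _ _ Sxn (SX (n %/ m)%N); congr S.
  rewrite -mulgA; congr (_ * _)%g; apply: (@mulgI _ (g ^+ n)%g); rewrite mulVKg.
  by rewrite {2}(divn_eq n m) expgnDr mulgK.
by apply: finite_image; apply: finite_setX => //; exact: finite_II.
Qed.

(* For [g] outside [S], both [adjoin S g] and, unless [g ^+ 2] is in [S],
   [adjoin S (g ^+ 2)] are the whole group, so [g] has finite order modulo [S]. *)
Lemma normal_subgroup_trivial (S : set G) : is_subgroup S -> normal_set S ->
  S <> setT -> S = [set 1%g].
Proof.
move=> sS nS ST; have [//|S1] := pselect (S = [set 1%g]); exfalso.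
have fS := finite_proper_subgroup sS ST.
have adjT g : ~ S g -> adjoin S g = setT.
  move=> Sg; have [//|aT] := pselect (adjoin S g = setT); case: Sg.
  have -> := subgroup_eq sS (adjoin_subgroup g sS nS) S1 aT (@subset_adjoin S g).
  exact: adjoin_mem.
have [g Sg] : exists g, ~ S g.
  apply: contrapT => /forallNP h; apply: ST; apply/seteqP; split => // x _.
  exact: contrapT.
suff [m m0 Sm] : exists2 m, (0 < m)%N & S (g ^+ m)%g.
  by apply: infG; rewrite -(adjT _ Sg); exact: finite_adjoin Sm.
have [Sg2|Sg2] := pselect (S (g ^+ 2)%g); first by exists 2.
have : adjoin S (g ^+ 2)%g g by rewrite adjT.
case: sS => S0 SM SV [i [j]]; rewrite -!expgnA -expgSr => Sij.
(* The exponent [2i + 1 - 2j] is odd, hence nonzero; if negative, the inverse element is taken. *)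
have [ij|ij] := leqP (2 * j) (2 * i).+1.
  by exists ((2 * i).+1 - 2 * j)%N; [lia|rewrite expgnFr].
exists (2 * j - (2 * i).+1)%N; first lia.
by rewrite expgnFr; [have := SV _ Sij; rewrite invgM invgK|lia].
Qed.

(** * Actions covered by finitely many fixed-point sets *)

Section StabilizersCovered.
Variables (X : Type) (act : G -> X -> X).
Hypothesis act1 : forall x, act 1%g x = x.
Hypothesis actM : forall g h x, act (g * h)%g x = act g (act h x).

Definition stabilizer (x : X) : set G := [set g | act g x = x].

Lemma stabilizer_subgroup x : is_subgroup (stabilizer x).
Proof.
split; first exact: act1.
- by move=> g h gx hx; rewrite /stabilizer /= actM hx.
- by move=> g gx; rewrite /stabilizer /= -{1}gx -actM mulVg act1.
Qed.

Lemma stabilizer_act g x h :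
  stabilizer (act g x) h <-> stabilizer x (g^-1 * h * g)%g.
Proof.
rewrite /stabilizer /= !actM; split => [->|hx]; first by rewrite -actM mulVg act1.
by rewrite -{2}hx -!actM !mulgA mulgV mul1g.
Qed.

(* Stabilizers sharing a nontrivial element coincide, so there are finitely
   many of them; a point stabilizer then has finitely many conjugates, and is
   normal because a proper normalizer would be finite. *)
Lemma no_finite_covering_by_fixed_points (F : set G) : finite_set F ->
  ~ F 1%g -> (forall x, stabilizer x <> setT) ->
  (forall x, exists2 k, F k & stabilizer x k) -> X -> False.
Proof.
move=> fF F1 sT cov x0.
have sub := stabilizer_subgroup.
have n1 x : stabilizer x <> [set 1%g].
  by move=> x1; have [k Fk] := cov x; rewrite x1 => k1; rewrite k1 in Fk.
have same x y k : F k -> stabilizer x k -> stabilizer y k -> stabilizer x = stabilizer y.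
  move=> Fk kx ky.
  have sI : is_subgroup (stabilizer x `&` stabilizer y).
    have [x1 xM xV] := sub x; have [y1 yM yV] := sub y; split => //.
    - by move=> a b [ax ay] [bx bY]; split; [exact: xM|exact: yM].
    - by move=> a [ax ay]; split; [exact: xV|exact: yV].
  have I1 : stabilizer x `&` stabilizer y <> [set 1%g].
    move=> I1; have : (stabilizer x `&` stabilizer y) k by [].
    by rewrite I1 => k1; rewrite k1 in Fk.
  rewrite -(subgroup_eq sI (sub x) I1 (sT x)); last by move=> ? [].
  by apply: subgroup_eq I1 (sT y) _ => // ? [].
(* The stabilizer of [act g x0] is the conjugate by [g], so [N] is the normalizer of the stabilizer
   of [x0]. *)
pose N : set G := [set g | stabilizer (act g x0) = stabilizer x0].
have sN : is_subgroup N.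
  split; first by rewrite /N /= act1.
  - move=> g h; rewrite /N /= actM => gN hN; rewrite -[RHS]gN.
    by apply/seteqP; split => k /stabilizer_act; rewrite ?hN => ?;
      apply/stabilizer_act; rewrite ?hN.
  - move=> g; rewrite /N /= => gN; apply/seteqP; split => k.
      move/stabilizer_act; rewrite -{1}gN => /stabilizer_act.
      by rewrite invgK !mulgA mulVg mul1g mulgVK.
    move=> kx; apply/stabilizer_act; rewrite -gN; apply/stabilizer_act.
    by rewrite invgK !mulgA mulVg mul1g mulgVK.
have NT : N = setT.
  apply: contrapT => NT; have fN := finite_proper_subgroup sN NT.
  have /choice [k Pk] : forall g, exists k, F k /\ stabilizer (act g x0) k.
    by move=> g; have [k] := cov (act g x0); exists k.
  (* If [k] fixes both [act g x0] and [act (r k) x0], their stabilizers agree and [g] lies in the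
     coset [r k N]. Thus finitely many cosets of a finite [N] would exhaust [G]. *)
  have /choice [r Pr] : forall k, exists r : G,
      (exists g, stabilizer (act g x0) k) -> stabilizer (act r x0) k.
    move=> l; have [[g gl]|nl] := pselect (exists g, stabilizer (act g x0) l).
      by exists g.
    by exists 1%g.
  apply: infG.
  apply: (@sub_finite_set _ _ ((fun kn => r kn.1 * kn.2)%g @` (F `*` N)));
    last first.
    by apply: finite_image; apply: finite_setX.
  move=> g _; exists (k g, ((r (k g))^-1 * g)%g) => /=; last by rewrite mulVKg.
  have [Fk kg] := Pk g; split => //.
  have kr := Pr (k g) (ex_intro _ g kg).
  have E := same _ _ _ Fk kr kg.
  rewrite /N /= actM; apply/seteqP; split => l.
    move/stabilizer_act; rewrite -E => /stabilizer_act.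
    by rewrite invgK !mulgA mulVg mul1g mulgVK.
  move=> lx; apply/stabilizer_act; rewrite -E; apply/stabilizer_act.
  by rewrite invgK !mulgA mulVg mul1g mulgVK.
apply: (n1 x0); apply: normal_subgroup_trivial => //.
move=> g x xS; have : N g by rewrite NT.
by rewrite /N /= => <-; apply/stabilizer_act; rewrite !mulgA mulVg mul1g mulgVK.
Qed.
End StabilizersCovered.

Lemma topologically_free_of_moving (X : topologicalType) (act : G -> X -> X) :
  is_continuous_action act -> compact [set: X] -> minimal_action act ->
  (forall x, stabilizer act x <> setT) -> topologically_free act.
Proof.
move=> [actC act1 actM] cX minX sT s s1 O O0 oO; apply: contrapT => OF.
have fixO x : O x -> act s x = x.
  by move=> Ox; apply: contrapT => sx; apply: OF; exists x.
have [x0 Ox0] := O0.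
(* Every orbit meets [O], so its preimages cover [X]; on the preimage under [act g], the conjugate
   [g^-1 * s * g] acts trivially. *)
have [|x _|D cov] :=
  @compact_finite_cover X setT G (fun g => act g @^-1` O) cX.
- by move=> g; apply: open_comp => // x _; exact: actC.
- have : closure (Defs.orbit act x) x0 by rewrite minX.
  by case/(_ O (open_nbhs_nbhs (conj oO Ox0))) => _ [[g _ <-] Ogx]; exists g.
apply: (@no_finite_covering_by_fixed_points X act act1 actM
  ((fun g => g^-1 * s * g)%g @` [set` D]) _ _ sT _ x0).
- by apply: finite_image; exact: finite_fset.
- move=> [g _ gs]; apply: s1.
  have -> : (s = g * (g^-1 * s * g) * g^-1)%g by rewrite !mulgA mulgV mul1g mulgK.
  by rewrite gs mulg1 mulgV.
- move=> x; have [g Dg Ogx] := cov x Logic.I.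
  exists (g^-1 * s * g)%g; first by exists g.
  by apply/(stabilizer_act act1 actM); exact: fixO.
Qed.

End SubgroupsOfBoundedOrder.

(** * Global fixed points and Tarski monsters *)

Lemma fixed_point_singleton (G : groupType) (X : topologicalType)
    (act : G -> X -> X) (x : X) : hausdorff_space X -> minimal_action act ->
  stabilizer act x = setT -> forall y, y = x.
Proof.
move=> hX minX fx y; apply: contrapT => yx.
have : closure [set x] y.
  (* The orbit of a global fixed point is a single point, at once dense and closed. *)
  have <- : Defs.orbit act x = [set x]; last by rewrite minX.
  apply/seteqP; split => [_ [g _ <-]|_ ->].
    by have : stabilizer act x g by rewrite fx.
  by exists 1%g => //; have : stabilizer act x 1%g by rewrite fx.
by move/(accessible_closed_set1 (hausdorff_accessible hX)).
Qed.

Theorem theorem6p5 (G : groupType) (HG : is_tarski_monster G)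
  (X : topologicalType) (act : G -> X -> X) (HX : furstenberg_boundary act) :
  topologically_free act.
Proof.
have [p [_ _ infG namG cyclic_proper]] := HG.
have [[actX [compX hausX _] minX _] univX] := HX.
have card_proper (H : set G) : is_subgroup H -> H <> [set 1%g] -> H <> setT ->
    (H #= `I_p)%card.
  by move=> sH H1 HT; have [g []] := cyclic_proper H sH H1 HT.
apply: (topologically_free_of_moving infG card_proper actX compX minX) => x fx.
(* A global fixed point would reduce [X] to one point, which cannot map onto a boundary with two
   points. *)
have [Y [actY [y [z [bY yz]]]]] := nonamenable_nontrivial_boundary namG.
have [f [_ _ surjf]] := univX Y actY bY.
have single := fixed_point_singleton hausX minX fx.
have fE w : w = f x.
  have : (f @` setT) w by rewrite surjf.
  by move=> [v _ <-]; rewrite (single v).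
by apply: yz; rewrite (fE y) (fE z).
Qed.
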